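(* Let $\tau$ be a self-similar tile set. Then every $\tau$-tiling is aperiodic, i.e., there is no nonzero vector $T\in\mathbb{Z}^2$ with $U(x+T)=U(x)$ for all $x\in\mathbb{Z}^2$, where $U$ is the tiling.
   Context: Fix a finite set $C$ of colors. A tile is a quadruple $(\ell,r,t,b)\in C^4$ (left, right, top, bottom colors); a tile set is a subset $\tau\subset C^4$. A $\tau$-tiling is a map $U\colon\mathbb{Z}^2\to\tau$ such that neighboring tiles match: the right color of $U(x,y)$ equals the left color of $U(x+1,y)$, and the top color of $U(x,y)$ equals the bottom color of $U(x,y+1)$. A tiling is periodic if it has a nonzero period $T\in\mathbb{Z}^2$ ($U(x+T)=U(x)$ for all $x$), otherwise aperiodic. Fix an integer $N>1$. A $\tau$-macro-tile is an $N\times N$ square filled with matching $\tau$-tiles; each side of a macro-tile carries a sequence of $N$ colors (its macro-color). For a set $\rho$ of $\tau$-macro-tiles, $\tau$ simulates $\rho$ if (a) $\tau$-tilings exist, and (b) for every $\tau$-tiling there is a unique grid of vertical and horizontal lines cutting the tiling into $N\times N$ macro-tiles all belonging to $\rho$. Two tile sets (tiles or macro-tiles) are isomorphic if there is a bijection between them preserving the relations ''one tile can be placed to the right of another'' (right (macro-)color of the first equals left (macro-)color of the second) and ''one tile can be placed on top of another'' (top of the lower equals bottom of the upper). A tile set $\tau$ is self-similar if, for some $N>1$, $\tau$ simulates some set $\rho$ of $N\times N$ $\tau$-macro-tiles that is isomorphic to $\tau$. *)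

(* Defs.v *)
From HB Require Import structures.
From mathcomp Require Import all_boot all_order all_algebra.

Set Implicit Arguments.
Unset Strict Implicit.
Unset Printing Implicit Defensive.

Import Order.TTheory GRing.Theory Num.Theory.
Local Open Scope ring_scope.

(* A tile is the quadruple (left, right, top, bottom). *)
Definition tile (C : finType) : finType := (C * C * C * C)%type.

Section Tiles.
Variable C : finType.

Definition left_color (t : tile C) : C := t.1.1.1.
Definition right_color (t : tile C) : C := t.1.1.2.
Definition top_color (t : tile C) : C := t.1.2.
Definition bottom_color (t : tile C) : C := t.2.

(* [right_of t t']: t' can be placed to the right of t.
   [on_top t t']: t' can be placed on top of t. *)
Definition right_of (t t' : tile C) : bool := right_color t == left_color t'.
Definition on_top (t t' : tile C) : bool := top_color t == bottom_color t'.

Definition tiling (tau : {set tile C}) (U : int * int -> tile C) : Prop :=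
  [/\ forall x y, U (x, y) \in tau,
      forall x y, right_of (U (x, y)) (U (x + 1, y)) &
      forall x y, on_top (U (x, y)) (U (x, y + 1))].

Definition periodic (U : int * int -> tile C) : Prop :=
  exists2 T : int * int, T != 0 & forall x, U (x + T) = U x.

Definition aperiodic (U : int * int -> tile C) : Prop := ~ periodic U.

(* In position (i, j) of an N x N square, i is the horizontal coordinate
   (growing to the right) and j the vertical one (growing upwards). *)
Definition square (N : nat) : finType := {ffun 'I_N * 'I_N -> tile C}.

Definition macro_tile (tau : {set tile C}) (N : nat) (M : square N) : Prop :=
  [/\ forall i j, M (i, j) \in tau,
      forall i i' j : 'I_N, i' = i.+1 :> nat -> right_of (M (i, j)) (M (i', j)) &
      forall i j j' : 'I_N, j' = j.+1 :> nat -> on_top (M (i, j)) (M (i, j'))].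

Section MacroColors.
Variable n : nat.

Definition macro_color := {ffun 'I_n.+1 -> C}.

Definition left_macro_color (M : square n.+1) : macro_color :=
  [ffun j => left_color (M (ord0, j))].
Definition right_macro_color (M : square n.+1) : macro_color :=
  [ffun j => right_color (M (ord_max, j))].
Definition top_macro_color (M : square n.+1) : macro_color :=
  [ffun i => top_color (M (i, ord_max))].
Definition bottom_macro_color (M : square n.+1) : macro_color :=
  [ffun i => bottom_color (M (i, ord0))].

Definition macro_right_of (M M' : square n.+1) : bool :=
  right_macro_color M == left_macro_color M'.
Definition macro_on_top (M M' : square n.+1) : bool :=
  top_macro_color M == bottom_macro_color M'.

End MacroColors.

(* The N x N square of U whose lower left cell is p. *)
Definition block (N : nat) (U : int * int -> tile C) (p : int * int) : square N :=
  [ffun c : 'I_N * 'I_N => U (p.1 + c.1%:Z, p.2 + c.2%:Z)].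

(* A grid with N x N cells is given by the residues mod N of the positions of
   its vertical and horizontal lines, so that distinct g : 'I_N * 'I_N are
   distinct grids. *)
Definition grid_cuts (N : nat) (rho : {set square N})
    (U : int * int -> tile C) (g : 'I_N * 'I_N) : Prop :=
  forall k l : int,
    block N U (g.1%:Z + N%:Z * k, g.2%:Z + N%:Z * l) \in rho.

Definition simulates (tau : {set tile C}) (N : nat) (rho : {set square N}) : Prop :=
  (exists U, tiling tau U) /\
  (forall U, tiling tau U -> exists! g : 'I_N * 'I_N, grid_cuts rho U g).

End Tiles.

(* hS, hT: horizontal adjacency; vS, vT: vertical adjacency. *)
Definition isomorphic (S T : finType) (hS vS : rel S) (hT vT : rel T)
    (A : {set S}) (B : {set T}) : Prop :=
  exists f : S -> T,
    [/\ {in A &, injective f}, f @: A = B,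
        {in A &, forall s s', hT (f s) (f s') = hS s s'} &
        {in A &, forall s s', vT (f s) (f s') = vS s s'}].

(* The size of the macro-tiles is N = n.+1. *)
Definition self_similar (C : finType) (tau : {set tile C}) : Prop :=
  exists n (rho : {set square C n.+1}),
    [/\ (1 < n.+1)%N,
        forall M, M \in rho -> macro_tile tau M,
        simulates tau rho &
        isomorphic (@right_of C) (@on_top C)
                   (@macro_right_of C n) (@macro_on_top C n) tau rho].

(* Main.v *)
(** A period of a tiling carries its unique grid of macro-tiles to another such
    grid, hence to itself, so it is divisible by the zoom factor [N].  Reading
    each macro-tile through the isomorphism as a single tile then gives a tiling
    of which the period divided by [N] is a period: infinite descent. *)

Require Import Defs.
From mathcomp Require Import all_boot all_order all_algebra.
From mathcomp Require Import zify.

Set Implicit Arguments.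
Unset Strict Implicit.
Unset Printing Implicit Defensive.

Import Order.TTheory GRing.Theory Num.Theory.
Local Open Scope ring_scope.

Section Residue.
Variable n : nat.

(** The remainder modulo [n.+1] is nonnegative and less than [n.+1], so neither the absolute value
    nor [inord] alters it. *)
Definition residue (a : int) : 'I_n.+1 := inord `|(a %% n.+1%:Z)%Z|.

Lemma residueE (a : int) :
  a = (residue a : nat)%:Z + n.+1%:Z * (a %/ n.+1%:Z)%Z.
Proof.
have r_ge0 : 0 <= (a %% n.+1%:Z)%Z by rewrite modz_ge0.
have r_lt : (a %% n.+1%:Z)%Z < n.+1%:Z by rewrite ltz_pmod.
rewrite /residue inordK; last by lia.
by rewrite gez0_abs // {1}(divz_eq a n.+1%:Z) addrC mulrC.
Qed.

End Residue.

Section Blocks.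
Variables (C : finType) (U : int * int -> tile C).

Lemma block_add_period (N : nat) (T p : int * int) :
  (forall x, U (x + T) = U x) -> block N U (p + T) = block N U p.
Proof.
move=> UT; apply/ffunP => c; rewrite !ffunE -(UT (p.1 + _, _)) /=.
by congr (U (_, _)); rewrite addrAC.
Qed.

(** The translated offset may leave ['I_n.+1]; reducing it only renumbers the blocks of the grid. *)
Lemma grid_cuts_add_period (n : nat) (rho : {set square C n.+1})
    (T : int * int) (g : 'I_n.+1 * 'I_n.+1) :
  (forall x, U (x + T) = U x) -> grid_cuts rho U g ->
  grid_cuts rho U (residue n (g.1%:Z + T.1), residue n (g.2%:Z + T.2)).
Proof.
move=> UT cut k l /=.
set q1 := ((g.1%:Z + T.1) %/ n.+1%:Z)%Z; set q2 := ((g.2%:Z + T.2) %/ n.+1%:Z)%Z.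
have E1 := residueE n (g.1%:Z + T.1); have E2 := residueE n (g.2%:Z + T.2).
(* Block [(k, l)] of the new grid is the [T]-translate of block [(k - q1, l - q2)] of the old
   one. *)
have -> : ((residue n (g.1%:Z + T.1) : nat)%:Z + n.+1%:Z * k,
           (residue n (g.2%:Z + T.2) : nat)%:Z + n.+1%:Z * l) =
    (g.1%:Z + n.+1%:Z * (k - q1), g.2%:Z + n.+1%:Z * (l - q2)) + T.
  by congr (_, _) => /=; rewrite mulrBr; lia.
by rewrite block_add_period //; apply: cut.
Qed.

Variable tau : {set tile C}.
Hypothesis tilU : tiling tau U.

Lemma block_right_of (n : nat) (x y : int) :
  macro_right_of (block n.+1 U (x, y)) (block n.+1 U (x + n.+1%:Z, y)).
Proof.
case: tilU => _ hU _; apply/eqP/ffunP => j; rewrite !ffunE /=.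
(* The last column sits at offset [n], so one more cell to the right is column 0 of the next
   block. *)
have /eqP -> := hU (x + n%:Z) (y + j%:Z).
by congr (left_color (U (_, _))); lia.
Qed.

Lemma block_on_top (n : nat) (x y : int) :
  macro_on_top (block n.+1 U (x, y)) (block n.+1 U (x, y + n.+1%:Z)).
Proof.
case: tilU => _ _ vU; apply/eqP/ffunP => i; rewrite !ffunE /=.
have /eqP -> := vU (x + i%:Z) (y + n%:Z).
by congr (bottom_color (U (_, _))); lia.
Qed.

Lemma period_multiple (n : nat) (rho : {set square C n.+1}) (T : int * int) :
  (exists! g, grid_cuts rho U g) -> (forall x, U (x + T) = U x) ->
  exists q : int * int, T = (n.+1%:Z * q.1, n.+1%:Z * q.2).
Proof.
move=> [g [cut uniq_g]] UT.
have [Eg1 Eg2] : g.1 = residue n (g.1%:Z + T.1) /\ g.2 = residue n (g.2%:Z + T.2).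
  by have := uniq_g _ (grid_cuts_add_period UT cut); case: (g) => ? ? [].
exists (((g.1%:Z + T.1) %/ n.+1%:Z)%Z, ((g.2%:Z + T.2) %/ n.+1%:Z)%Z).
(* As the residue is [g.1] itself, it cancels and leaves [T.1] equal to [n.+1] times the quotient;
   likewise for [T.2]. *)
have := residueE n (g.1%:Z + T.1); rewrite -Eg1 => /addrI /= <-.
have := residueE n (g.2%:Z + T.2); rewrite -Eg2 => /addrI /= <-.
by case: T {UT Eg1 Eg2}.
Qed.

Lemma macro_tiling_pullback (n : nat) (rho : {set square C n.+1})
    (g : 'I_n.+1 * 'I_n.+1) :
  isomorphic (@right_of C) (@on_top C)
             (@macro_right_of C n) (@macro_on_top C n) tau rho ->
  grid_cuts rho U g ->
  exists2 V : int * int -> tile C, tiling tau V &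
    forall q : int * int,
      (forall x, U (x + (n.+1%:Z * q.1, n.+1%:Z * q.2)) = U x) ->
      forall x, V (x + q) = V x.
Proof.
move=> [f [_ f_im f_h f_v]] cut.
pose B (p : int * int) :=
  block n.+1 U (g.1%:Z + n.+1%:Z * p.1, g.2%:Z + n.+1%:Z * p.2).
(* A right inverse of [f] on [rho]; the default [U 0] is never reached on blocks of the grid. Since
   [h] sees only the content of a block, equal blocks yield equal tiles. *)
pose h M := odflt (U 0) [pick s in tau | f s == M].
have hP p : h (B p) \in tau /\ f (h (B p)) = B p.
  have : B p \in f @: tau by rewrite f_im; apply: cut.
  case/imsetP => s s_tau Bs; rewrite /h.
  case: pickP => [t /andP[t_tau /eqP] //|/(_ s)].
  by rewrite s_tau Bs eqxx.
exists (h \o B) => [|q Uq x /=].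
  split=> x y /=; first by have [] := hP (x, y).
  - have [t1 E1] := hP (x, y); have [t2 E2] := hP (x + 1, y).
    rewrite -f_h // E1 E2 /B /= mulrDr mulr1 addrA; exact: block_right_of.
  - have [t1 E1] := hP (x, y); have [t2 E2] := hP (x, y + 1).
    rewrite -f_v // E1 E2 /B /= mulrDr mulr1 addrA; exact: block_on_top.
(* Moving the block index by [q] moves its corner by [n.+1] times [q], a period of [U]. *)
rewrite /B -[in RHS](block_add_period _ _ Uq); congr (h (block _ _ _)).
by congr (_, _) => /=; rewrite mulrDr addrA.
Qed.

End Blocks.

Theorem theorem2 (C : finType) (tau : {set tile C}) :
  self_similar tau ->
  forall U : int * int -> tile C, tiling tau U -> aperiodic U.
Proof.
move=> [n [rho [n_gt1 _ [_ sim] iso]]] U tilU [T].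
(* The descent is on the 1-norm of the period, with [U] generalized because each step changes the
   tiling. *)
have [m] := ubnP (`|T.1| + `|T.2|)%N.
elim: m => // m IHm in U T tilU * => leTm T0 UT.
have [q Tq] := period_multiple (sim U tilU) UT.
have [g [cut _]] := sim U tilU.
have [V tilV Vq] := macro_tiling_pullback tilU iso cut.
rewrite {}Tq /= !abszM !absz_nat in leTm T0 UT.
have q0 : q != 0 by apply: contraNneq T0 => ->; rewrite /= !mulr0.
apply: (IHm V q tilV _ q0 (Vq q UT)).
(* The norm of [T] is [n.+1] times that of [q]; as [n.+1 > 1], a positive norm strictly
   decreases. *)
have : (0 < `|q.1| + `|q.2|)%N.
  by rewrite lt0n addn_eq0 !absz_eq0; apply: contraNN q0; case: (q).
nia.
Qed.
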